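(* For every positive integer $n$, the optimal pegging number of the hypercube $Q_n$ satisfies \[ \left(\sqrt{5}-1\right)^n \le p(Q_n) \le (2n)^{3/2}\left(\sqrt{5}-1\right)^n. \]
   Context: $Q_n$ is the Cartesian product of $n$ copies of $K_2$, i.e. the graph on binary $n$-tuples with two tuples adjacent iff they differ in exactly one coordinate. A distribution of pegs on a graph $\Gamma$ is a subset $D \subseteq V(\Gamma)$. If $u,v \in D$ are distinct adjacent vertices and $w \notin D$ is a vertex adjacent to $v$, the pegging move (jumping $u$ over $v$ into $w$) replaces $D$ by $(D\setminus\{u,v\})\cup\{w\}$. A vertex $t$ is reachable from $D$ if some finite (possibly empty) sequence of pegging moves starting from $D$ ends in a distribution containing $t$; $\mathrm{Reach}(D)$ is the set of reachable vertices. The optimal pegging number $p(\Gamma)$ is the smallest positive integer $d$ such that some distribution of size $d$ on $\Gamma$ has reach $V(\Gamma)$. *)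

(* Defs.v *)
From mathcomp Require Import all_boot.

Set Implicit Arguments.
Unset Strict Implicit.
Unset Printing Implicit Defensive.

(* A graph is given by its adjacency relation [e] on a finite vertex type,    *)
(* a distribution of pegs by the set of occupied vertices.                    *)
Section Pegging.

Variables (T : finType) (e : rel T).
Implicit Types D : {set T}.

Definition pegging_move : rel {set T} := fun D D' =>
  [exists u, exists v, exists w,
    [&& u \in D, v \in D, u != v, e u v, w \notin D, e v w
      & D' == w |: (D :\: [set u; v])]].

Definition Reach D : {set T} :=
  [set t | [exists D', connect pegging_move D D' && (t \in D')]].

Definition solvable_size (d : nat) : bool :=
  (0 < d) && [exists D : {set T}, (#|D| == d) && (Reach D == [set: T])].

(* No distribution has more than #|T| pegs, so the minimum is taken over      *)
(* [0, #|T|]; when T is nonempty the default #|T| satisfies the condition.    *)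
(* The value for an empty T is meaningless.                                   *)
Definition optimal_pegging_number : nat :=
  [arg min_(d < (ord_max : 'I_#|T|.+1) | solvable_size d) (d : nat)].

Lemma sub_Reach D : D \subset Reach D.
Proof.
apply/subsetP=> t tD; rewrite inE; apply/existsP; exists D.
by rewrite connect0.
Qed.

Lemma optimal_pegging_numberP : 0 < #|T| ->
  solvable_size optimal_pegging_number /\
  (forall d, solvable_size d -> optimal_pegging_number <= d).
Proof.
move=> T_gt0; rewrite /optimal_pegging_number.
case: arg_minnP => [|p p_ok p_min].
  rewrite /solvable_size /= T_gt0; apply/existsP; exists setT.
  by rewrite cardsT eqxx eqEsubset subsetT sub_Reach.
split=> // d d_ok.
have lt_d : d < #|T|.+1.
  by case/andP: d_ok => _ /existsP[D /andP[/eqP <- _]]; rewrite ltnS max_card.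
exact: (p_min (Ordinal lt_d)).
Qed.

End Pegging.

Definition hypercube (n : nat) : rel (n.-tuple bool) := fun x y =>
  #|[set i : 'I_n | tnth x i != tnth y i]| == 1.

(* Main.v *)
Require Import Defs.
From mathcomp Require Import all_boot all_order all_algebra.
From mathcomp Require Import ring lra.
From mathcomp Require Import reals sequences exp.
Import Order.TTheory GRing.Theory Num.Theory.

(* Let sigma = (sqrt 5 - 1) / 2, so that sigma + sigma^2 = 1.                 *)
(*   Lower bound: the weight of D seen from t, the sum of sigma^dist(x, t)    *)
(* over x in D, does not increase under a pegging move, so it is at least 1   *)
(* when t is reachable.  Summing over t gives 2^n <= #|D| (1 + sigma)^n.      *)
(*   Upper bound: a k-dimensional subcube full of pegs reaches every vertex   *)
(* at distance at most k from it, since the moves along one free direction    *)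
(* collapse it to a full (k-1)-dimensional subcube one step closer.  A greedy *)
(* covering by parallel k-subcubes then needs at most                         *)
(* (7n/10 + 1) 2^n / C(n-k, k) pegs.  The numbers C(n-k, k) sigma^n are the   *)
(* probabilities that a walk with steps 1 and 2, of probabilities sigma and   *)
(* sigma^2, visits n with k double steps; Chebyshev's inequality for this     *)
(* walk shows that one of them is of order 1 / sqrt n.  The constants work    *)
(* for n >= 10, and the trivial bound 2^n is enough for n <= 9.               *)

Set Implicit Arguments.
Unset Strict Implicit.
Unset Printing Implicit Defensive.

(** * Pegging and greedy coverings *)

(** A jump replaces pegs at distances at most d+1 and d+2 from a target by one at distance d, and
    sigma^(d+1) + sigma^(d+2) = sigma^d. So the weight is a potential ([weight_move]), and summing
    it over all targets gives [pegging_lower_bound]. Conversely, a full k-subcube can bridge k units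
    of distance ([subcube_reach]), and a greedy cover by such subcubes loses only a factor linear in
    n ([pegging_upper_binomial]). The numbers C(n-k, k) sigma^n have a sum bounded below and
    concentrate on about sqrt n values of k, so one of them is of order 1 / sqrt n
    ([exists_large_binomial]). The factors n and sqrt n make up the exponent 3/2. *)

Section Pegging.
Variables (T : finType) (e : rel T).
Implicit Types D E : {set T}.

(** An extra peg can block the jump only by occupying its target [w]; then [E] already contains the
    result and no move is made. *)
Lemma pegging_move_mono D E D' : D \subset E -> pegging_move e D D' ->
  exists2 E', connect (pegging_move e) E E' & D' \subset E'.
Proof.
move=> sDE /existsP[u /existsP[v /existsP[w]]].
case/and5P=> uD vD uv euv /and3P[wD evw /eqP ->].
have [wE|wE] := boolP (w \in E).
  exists E; rewrite ?connect0 // subUset sub1set wE.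
  exact: subset_trans (subsetDl _ _) sDE.
exists (w |: (E :\: [set u; v])); last by rewrite setUS // setSD.
apply/connect1/existsP; exists u; apply/existsP; exists v; apply/existsP.
by exists w; rewrite !(subsetP sDE _ uD) (subsetP sDE _ vD) uv euv wE evw eqxx.
Qed.

Lemma connect_pegging_mono D E D' : D \subset E ->
  connect (pegging_move e) D D' ->
  exists2 E', connect (pegging_move e) E E' & D' \subset E'.
Proof.
move=> sDE /connectP[p]; elim: p D E sDE => [|D1 p IHp] D E sDE /=.
  by move=> _ ->; exists E; rewrite ?connect0.
case/andP=> mD pD1 D'E; have [E1 cE1 sE1] := pegging_move_mono sDE mD.
have [E2 cE2 sE2] := IHp _ _ sE1 pD1 D'E.
by exists E2 => //; apply: connect_trans cE1 cE2.
Qed.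

Lemma ReachP D t :
  reflect (exists2 D', connect (pegging_move e) D D' & t \in D')
          (t \in Reach e D).
Proof.
rewrite inE; apply: (iffP existsP) => [[D' /andP[]]|[D' cD tD]]; exists D' => //.
by rewrite cD.
Qed.

Lemma Reach_mono D E : D \subset E -> Reach e D \subset Reach e E.
Proof.
move=> sDE; apply/subsetP=> t /ReachP[D' cD tD'].
have [E' cE sE'] := connect_pegging_mono sDE cD.
by apply/ReachP; exists E' => //; apply: (subsetP sE').
Qed.

(* All jumps of [f x] over [x] into [g x], for x in X, are carried out one    *)
(* after the other; A collects the pegs that must survive.                    *)
Lemma pegging_parallel (f g : T -> T) (X A D : {set T}) :
    injective f ->
    {in X, forall x, [&& e (f x) x & e x (g x)]} ->
    {in X &, forall x y, [&& f x != y, g x != y & g x != f y]} ->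
    {in X, forall x, [&& x \notin A & f x \notin A]} ->
    A :|: X :|: f @: X \subset D ->
  exists2 D', connect (pegging_move e) D D' & A :|: g @: X \subset D'.
Proof.
move=> f_inj; have [m] := ubnP #|X|; elim: m X A D => // m IHm X A D.
rewrite ltnS => leX adj sepX sepA sD.
have [X0|[x xX]] := set_0Vmem X.
  exists D; rewrite ?connect0 //; apply: subset_trans sD.
  by rewrite X0 !imset0 !setU0.
have xD : x \in D by apply: (subsetP sD); rewrite !inE xX orbT.
have fxD : f x \in D by apply: (subsetP sD); rewrite !inE imset_f ?orbT.
have gX : g @: X = g x |: g @: (X :\ x) by rewrite -imsetU1 setD1K.
have [D1 cD1 sD1] : exists2 D1, connect (pegging_move e) D D1 &
    (g x |: A) :|: (X :\ x) :|: f @: (X :\ x) \subset D1.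
  have sD0 : A :|: (X :\ x) :|: f @: (X :\ x) \subset D.
    apply: subset_trans sD; apply: setUSS; last by rewrite imsetS ?subD1set.
    by rewrite setUS ?subD1set.
  have [gxD|gxD] := boolP (g x \in D).
    by exists D; rewrite ?connect0 // -!setUA subUset sub1set gxD /= setUA.
  exists (g x |: (D :\: [set f x; x])).
    apply/connect1/existsP; exists (f x); apply/existsP; exists x.
    apply/existsP; exists (g x).
    have /andP[-> ->] := adj _ xX; have /and3P[-> _ _] := sepX _ _ xX xX.
    by rewrite fxD xD gxD eqxx.
  rewrite -!setUA setUS // setUA subsetD sD0 /=.
  rewrite disjoint_sym disjoints_subset; apply/subsetP=> y.
  have /andP[xA fxA] := sepA _ xX; have /and3P[fxx _ _] := sepX _ _ xX xX.
  case/set2P=> ->; rewrite !inE !negb_or.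
    rewrite fxA negb_and negbK; apply/andP; split.
      (* If [f x] were in [X], then [sepX] at the pair [x], [f x] would say that [f x] differs from
         itself. *)
      apply/orP; right; apply/negP => fxX; have:= sepX _ _ xX fxX.
      by rewrite eqxx.
    by rewrite (mem_imset _ _ f_inj) !inE eqxx.
  rewrite xA eqxx; apply/imsetP=> -[y0]; rewrite 2!inE => /andP[_ yX] xE.
  by have /and3P[/eqP[]] := sepX _ _ yX xX.
have [||||D2 cD2 sD2] := IHm (X :\ x) (g x |: A) D1 _ _ _ _ sD1.
- by rewrite (leq_trans _ leX) // [leqRHS](cardsD1 x) xX.
- by move=> y; rewrite inE => /andP[_]; apply: adj.
- by move=> y z; rewrite !inE => /andP[_ yX] /andP[_ zX]; apply: sepX.
- move=> y; rewrite !inE => /andP[_ yX]; have /andP[yA fyA] := sepA _ yX.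
  rewrite !negb_or yA fyA eq_sym [f y == _]eq_sym.
  by have /and3P[_ -> ->] := sepX _ _ xX yX.
exists D2; first exact: connect_trans cD1 cD2.
by rewrite gX setUCA setUA.
Qed.

End Pegging.

(** * Greedy covering for a relation of degree at least [d] *)

Section GreedyCover.
Variables (T : finType) (r : rel T) (d : nat).
Hypothesis r_deg : forall t, d <= #|[set c | r c t]|.

Definition uncovered (C : {set T}) := [set t | [forall c in C, ~~ r c t]].

(* Double counting: some c covers at least an average share of the points     *)
(* that are still uncovered.                                                  *)
Lemma greedy_step (U : {set T}) : 0 < #|T| ->
  exists c, d * #|U| <= #|T| * #|[set t in U | r c t]|.
Proof.
move=> /card_gt0P[t0 _]; apply/existsP; rewrite -[X in is_true X]negbK.
apply/negP=> /existsPn small.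
have: \sum_c #|[set t in U | r c t]| * #|T| < #|T| * (d * #|U|).
  rewrite -[X in X * (d * _)]sum1_card big_distrl /=.
  rewrite (bigD1 t0) //= [ltnRHS](bigD1 t0) //= -addSn mul1n.
  apply: leq_add; first by rewrite mulnC ltnNge small.
  by apply: leq_sum => c _; rewrite mulnC ltnW // ltnNge small.
rewrite -big_distrl /= mulnC ltn_mul2l => /andP[_]; rewrite ltnNge => /negP[].
under [leqRHS]eq_bigr => c _ do rewrite -sum1dep_card big_mkcondr /=.
rewrite exchange_big /= mulnC -sum_nat_const.
by apply: leq_sum => t _; rewrite -big_mkcond sum1dep_card r_deg.
Qed.

(** Each greedy choice multiplies the number of uncovered points by at most 1 - d / #|T|;
    denominators are cleared to stay in [nat]. *)
Lemma greedy_cover s : exists2 C : {set T},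
  #|C| <= s & #|uncovered C| * #|T| ^ s <= #|T| * (#|T| - d) ^ s.
Proof.
have [T0|Tgt0] := posnP #|T|.
  exists set0; rewrite ?cards0 // (_ : #|uncovered set0| = 0) //.
  by apply/eqP; rewrite -leqn0 -T0 max_card.
elim: s => [|s [C leC IHs]].
  by exists set0; rewrite ?cards0 // !muln1 max_card.
have [c cP] := greedy_step (uncovered C) Tgt0.
exists (c |: C); first by rewrite cardsU1 (leq_trans (leq_add (leq_b1 _) leC)).
have split_unc : #|uncovered C| =
    #|[set t in uncovered C | r c t]| + #|uncovered (c |: C)|.
  rewrite -(cardsID [set t | r c t] (uncovered C)); congr (_ + _).
    by apply: eq_card => t; rewrite !inE.
  apply: eq_card => t; rewrite !inE; apply/andP/forall_inP => [[nrct unc] x|].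
    by case/setU1P=> [->|xC] //; apply: (forall_inP unc).
  move=> unc; split; first by apply: unc; rewrite setU11.
  by apply/forall_inP=> x xC; apply: unc; rewrite setU1r.
have step : #|uncovered (c |: C)| * #|T| <= #|uncovered C| * (#|T| - d).
  rewrite mulnBr [_ * d]mulnC leq_subRL; last first.
    rewrite mulnC leq_mul2l; apply/orP; right.
    have [t _] := card_gt0P Tgt0.
    exact: leq_trans (r_deg t) (max_card _).
  apply: leq_trans (leq_add cP (leqnn _)) _.
  by rewrite [_ * #|T|]mulnC -mulnDr -split_unc mulnC.
rewrite !expnS mulnA (leq_trans (leq_mul step (leqnn _))) //.
by rewrite -mulnA [_ * (_ ^ _)]mulnC mulnA mulnCA [leqLHS]mulnC leq_mul2l IHs orbT.
Qed.

End GreedyCover.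

(** * Subcubes of the hypercube *)

Section Hypercube.
Variable n : nat.
Implicit Types (x y c t : n.-tuple bool) (A S : {set 'I_n}).

Definition diffset x y := [set i | tnth x i != tnth y i].
Definition flip x A := [tuple tnth x i (+) (i \in A) | i < n].

Lemma diffset_flip x A : diffset x (flip x A) = A.
Proof.
by apply/setP=> i; rewrite inE tnth_mktuple; case: (tnth x i) (i \in A) => [] [].
Qed.

Lemma flip_diffset x y : flip x (diffset x y) = y.
Proof.
by apply: eq_from_tnth => i; rewrite tnth_mktuple inE; do 2!case: (tnth _ i).
Qed.

Lemma flipK A : involutive (flip^~ A).
Proof. by move=> x; apply: eq_from_tnth => i; rewrite !tnth_mktuple addbK. Qed.

Lemma flip_inj x : injective (flip x).
Proof. exact: can_inj (diffset_flip x). Qed.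

Lemma diffsetC x y : diffset x y = diffset y x.
Proof. by apply/setP=> i; rewrite !inE eq_sym. Qed.

Lemma diffset_triangle x y z :
  diffset x z \subset diffset x y :|: diffset y z.
Proof.
apply/subsetP=> i; rewrite !inE.
by case: (tnth x i) (tnth y i) (tnth z i) => [] [] [].
Qed.

Lemma hypercube_flip1 x i : hypercube x (flip x [set i]).
Proof. by rewrite /hypercube -/(diffset _ _) diffset_flip cards1. Qed.

Lemma hypercube_sym x y : hypercube x y = hypercube y x.
Proof. by rewrite /hypercube -!/(diffset _ _) diffsetC. Qed.

Definition subcube S c := [set x | diffset c x \subset S].

Lemma card_subcube S c : #|subcube S c| = 2 ^ #|S|.
Proof.
rewrite -card_powerset -(card_imset _ (@flip_inj c)); apply: eq_card => x.
rewrite inE; apply/idP/imsetP => [sS|[A]]; last first.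
  by rewrite inE => sA ->; rewrite diffset_flip.
by exists (diffset c x); rewrite ?inE ?flip_diffset.
Qed.

(* Jumping along a free direction j into a direction i in which c and t       *)
(* differ trades one free dimension for one unit of distance.                 *)
Lemma subcube_reach S c t : #|diffset c t :\: S| <= #|S| ->
  t \in Reach (@hypercube n) (subcube S c).
Proof.
have [m] := ubnP #|S|; elim: m S c => // m IHm S c; rewrite ltnS => leS le_t.
have [d0|[i]] := set_0Vmem (diffset c t :\: S).
  by apply: (subsetP (sub_Reach _ _)); rewrite inE -setD_eq0 d0.
rewrite inE => /andP[iS ict].
have [j jS] : exists j, j \in S.
  by apply/card_gt0P; apply: leq_trans le_t; apply/card_gt0P; exists i; rewrite inE iS.
have ji : j != i by apply: contraNneq iS => <-.
(* Once [j] is no longer free, the base point must agree with [t] there, so that [j] adds nothing to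
   the distance. The half of the subcube that disagrees with [t] at [j] jumps over the other
   half. *)
pose cj : n.-tuple bool := [tuple if l == j then tnth t l else tnth c l | l < n].
pose c1 := flip cj [set i].
have agree x l : diffset cj x \subset S :\ j -> (l \in S :\ j) = false ->
    tnth x l = tnth cj l.
  move=> /subsetP xS lS; apply/eqP; rewrite eq_sym; apply: contraFT lS => ne.
  by apply: xS; rewrite inE.
have ijS : (i \in S :\ j) = false by rewrite in_setD1 (negPf iS) andbF.
have [||||D' cD' sD'] := @pegging_parallel _ (@hypercube n) (flip^~ [set j])
   (flip^~ [set i]) (subcube (S :\ j) cj) set0 (subcube S c) (can_inj (flipK _)).
- by move=> x _; rewrite hypercube_sym !hypercube_flip1.
- move=> x y; rewrite !inE => xS yS.
  have [xi xj] := (agree _ _ xS ijS, agree _ _ xS (setD11 j S)).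
  have [yi yj] := (agree _ _ yS ijS, agree _ _ yS (setD11 j S)).
  apply/and3P; split.
  + apply/eqP=> /(congr1 (fun z => tnth z j)).
    by rewrite tnth_mktuple inE eqxx xj yj; case: (tnth cj j).
  + apply/eqP=> /(congr1 (fun z => tnth z i)).
    by rewrite tnth_mktuple inE eqxx xi yi; case: (tnth cj i).
  + apply/eqP=> /(congr1 (fun z => tnth z i)).
    rewrite !tnth_mktuple !inE eqxx [i == j]eq_sym (negPf ji) xi yi.
    by case: (tnth cj i).
- by move=> x _; rewrite !inE.
- rewrite set0U subUset; apply/andP; split; apply/subsetP => y.
    rewrite !inE => /subsetP yS; apply/subsetP=> l; have := yS l.
    rewrite !inE tnth_mktuple; case: (eqVneq l j) => [->|_] //=.
  case/imsetP=> x; rewrite !inE => /subsetP yS ->; apply/subsetP=> l.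
  have := yS l; rewrite !inE !tnth_mktuple inE; case: (eqVneq l j) => [->|_] //=.
  by rewrite addbF.
rewrite set0U in sD'.
have sub1 : subcube (S :\ j) c1 \subset D'.
  apply: subset_trans sD'; apply/subsetP => x; rewrite inE => xS.
  apply/imsetP; exists (flip x [set i]); last by rewrite flipK.
  rewrite inE; apply: subset_trans xS; apply/subsetP=> l.
  rewrite !inE !tnth_mktuple inE.
  by case: (l == i) (tnth x l) (if _ then _ else _) => [] [] [].
have cS : #|S| = #|S :\ j|.+1 by rewrite (cardsD1 j) jS.
have /ReachP[D2 cD2 tD2] : t \in Reach (@hypercube n) D'.
  apply: (subsetP (Reach_mono _ sub1)); apply: IHm; first by rewrite -cS.
  rewrite -ltnS -cS (leq_trans _ le_t) //.
  apply: proper_card; apply/properP; split; last first.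
    exists i; rewrite !inE ?iS //=; first by rewrite inE in ict.
    rewrite !tnth_mktuple !inE eqxx [i == j]eq_sym (negPf ji) (negPf iS) andbF /=.
    by move: ict; rewrite inE; case: (tnth c i) (tnth t i) => [] [].
  apply/subsetP=> l; rewrite !inE !tnth_mktuple !inE.
  case: (eqVneq l j) => [->|lj] /=.
    by rewrite (negPf ji) addbF eqxx.
  case: (eqVneq l i) => [->|li]; last by rewrite addbF.
  by rewrite iS; move: ict; rewrite inE; case: (tnth c i) (tnth t i) => [] [].
by apply/ReachP; exists D2 => //; apply: connect_trans cD' cD2.
Qed.

(** It is enough to count the centres at distance exactly [k] outside [S]: flip [t] on any subset of
    [S] and on any [k]-subset of its complement. *)
Lemma card_flat_ball S t k :
  2 ^ #|S| * 'C(n - #|S|, k) <= #|[set c | #|diffset c t :\: S| <= k]|.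
Proof.
have -> : n - #|S| = #|~: S| by rewrite [RHS]cardsCs setCK card_ord.
rewrite -card_powerset -cards_draws -cardsX.
rewrite -(@card_in_imset _ _
  (fun P : {set 'I_n} * {set 'I_n} => flip t (P.1 :|: P.2))).
  apply: subset_leq_card; apply/subsetP=> x /imsetP[[A B] /=].
  rewrite !inE /= => /andP[AS /andP[BS /eqP Bk]] ->.
  rewrite diffsetC diffset_flip -Bk; apply: subset_leq_card.
  rewrite setDUl subUset subsetDl (_ : A :\: S = set0) ?sub0set //.
  by apply/eqP; rewrite setD_eq0.
move=> [A B] [A' B']; rewrite !inE /=.
move=> /andP[AS /andP[BS _]] /andP[AS' /andP[BS' _]].
move/flip_inj => eqU.
have capS (X Y : {set 'I_n}) : X \subset S -> Y \subset ~: S ->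
    ((X :|: Y) :&: S = X) /\ ((X :|: Y) :\: S = Y).
  move=> XS YS; split.
    rewrite setIUl (setIidPl XS) (_ : Y :&: S = set0) ?setU0 //.
    by apply/eqP; rewrite setI_eq0 disjoints_subset.
  rewrite setDUl (_ : X :\: S = set0) ?set0U; last by apply/eqP; rewrite setD_eq0.
  by rewrite setDE; apply/setIidPl.
have [EA EB] := capS _ _ AS BS; have [EA' EB'] := capS _ _ AS' BS'.
by congr (_, _); [rewrite -EA eqU EA' | rewrite -EB eqU EB'].
Qed.

Lemma optimal_pegging_hypercube_le (D : {set n.-tuple bool}) :
  Reach (@hypercube n) D = setT -> optimal_pegging_number (@hypercube n) <= #|D|.
Proof.
move=> RD; have T0 : 0 < #|{: n.-tuple bool}| by rewrite card_tuple card_bool expn_gt0.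
have [_] := optimal_pegging_numberP (@hypercube n) T0; apply.
apply/andP; split; last by apply/existsP; exists D; rewrite eqxx RD /=.
have [t _] := card_gt0P T0.
have: t \in Reach (@hypercube n) D by rewrite RD.
case/ReachP=> D' /connectP[p]; case: p => [_ -> tD|D1 p /= /andP[]].
  by apply/card_gt0P; exists t.
by case/existsP=> u /existsP[v /existsP[w /andP[uD _]]] _ _ _; apply/card_gt0P; exists u.
Qed.

(** The hypothesis pushes the bound of [greedy_cover] on the number of uncovered vertices below 1,
    so none is left. *)
Lemma optimal_pegging_cover S s :
    let d := 2 ^ #|S| * 'C(n - #|S|, #|S|) in
    2 ^ n * (2 ^ n - d) ^ s < (2 ^ n) ^ s ->
  optimal_pegging_number (@hypercube n) <= s * 2 ^ #|S|.
Proof.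
move=> d small; have cT : #|{: n.-tuple bool}| = 2 ^ n by rewrite card_tuple card_bool.
have [C leC] := greedy_cover (fun t => card_flat_ball S t #|S|) s.
rewrite cT -/d => uncC.
have unc0 : uncovered (fun c t => #|diffset c t :\: S| <= #|S|) C = set0.
  apply/eqP; rewrite -cards_eq0 -leqn0 leqNgt; apply/negP=> ugt0.
  have := leq_ltn_trans uncC small.
  by rewrite ltnNge leq_pmull.
apply: (@leq_trans #|\bigcup_(c in C) subcube S c|); last first.
  rewrite (leq_trans (_ : _ <= \sum_(c in C) 2 ^ #|S|)) //; last first.
    by rewrite sum_nat_const leq_mul2r leC orbT.
  elim/big_rec2: _ => [|c m U _ leUm]; first by rewrite cards0.
  by rewrite (leq_trans (leq_card_setU _ _).1) // card_subcube leq_add2l.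
apply: optimal_pegging_hypercube_le; apply/setP=> t; rewrite in_setT.
have: t \notin uncovered (fun c t => #|diffset c t :\: S| <= #|S|) C by rewrite unc0 inE.
rewrite inE => /forall_inPn[c cC]; rewrite negbK => /subcube_reach.
by apply: (subsetP (Reach_mono _ _)); apply: bigcup_sup cC.
Qed.

End Hypercube.

Local Open Scope ring_scope.

(** * Large binomial coefficients on a diagonal *)

Section Sigma.
Variable R : realType.

Definition sigma : R := (Num.sqrt 5 - 1) / 2.

Lemma sqrt5_sigma : Num.sqrt 5 - 1 = 2 * sigma :> R.
Proof. by rewrite /sigma; field. Qed.

Lemma sigma_sqr : sigma ^+ 2 = 1 - sigma.
Proof.
have s5 : Num.sqrt 5 ^+ 2 = 5 :> R by rewrite sqr_sqrtr.
by rewrite /sigma expr_div_n sqrrB s5; field.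
Qed.

(** 55/89 and 34/55 are consecutive Fibonacci quotients enclosing [sigma], tight enough for the
    later rational estimates. *)
Lemma sigma_gt : 55 / 89 < sigma.
Proof.
have s0 : 0 <= sigma.
  by rewrite /sigma divr_ge0 // subr_ge0 -[leLHS]sqrtr1 ler_sqrt // ler1n.
have := sigma_sqr; nra.
Qed.

Lemma sigma_lt : sigma < 34 / 55.
Proof. have := sigma_sqr; have := sigma_gt; nra. Qed.

Lemma sigma_gt0 : 0 < sigma.
Proof. by have := sigma_gt; lra. Qed.

(** Expectation of [f](number of double steps) on the event that the walk visits [n]: each of the
    C(n-k, k) paths with k double steps has probability sigma^(n-2k) (sigma^2)^k = sigma^n. *)
Definition renewal n (f : nat -> R) :=
  \sum_(k < n.+1) 'C(n - k, k)%:R * sigma ^+ n * f k.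

(** Pascal's rule, that is, conditioning on the last step of the walk. *)
Lemma renewal_rec n f : renewal n.+2 f =
  sigma * renewal n.+1 f + sigma ^+ 2 * renewal n (f \o succn).
Proof.
rewrite /renewal big_ord_recl /= subn0 bin0.
rewrite [X in sigma * X]big_ord_recl /= subn0 bin0 mulrDr -addrA; congr (_ + _).
  by rewrite exprS; ring.
rewrite big_ord_recr /= subnn bin0n !mul0r addr0 !mulr_sumr -big_split /=.
apply: eq_bigr => k _; rewrite /bump /= !add1n !subSS subSn ?leq_ord //.
by rewrite binS natrD !exprS; ring.
Qed.

Lemma renewal_ge0 n f : (forall k, 0 <= f k) -> 0 <= renewal n f.
Proof.
move=> f0; apply: sumr_ge0 => k _.
by rewrite mulr_ge0 // mulr_ge0 // exprn_ge0 // ltW // sigma_gt0.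
Qed.

Lemma renewal0 f : renewal 0 f = f 0%N.
Proof. by rewrite /renewal big_ord1 expr0 !mul1r. Qed.

Lemma renewal1 f : renewal 1 f = sigma * f 0%N.
Proof. by rewrite /renewal big_ord_recl big_ord1 /= expr1 mul1r !mul0r addr0. Qed.

Lemma renewalD n f g :
  renewal n (fun k => f k + g k) = renewal n f + renewal n g.
Proof. by rewrite /renewal -big_split /=; apply: eq_bigr => k _; rewrite mulrDr. Qed.

Lemma renewalZ n a f : renewal n (fun k => a * f k) = a * renewal n f.
Proof. by rewrite /renewal mulr_sumr; apply: eq_bigr => k _; rewrite mulrCA. Qed.

Lemma eq_renewal n f g : f =1 g -> renewal n f = renewal n g.
Proof. by move=> fg; apply: eq_bigr => k _; rewrite fg. Qed.

Local Notation mass n := (renewal n (fun=> 1)).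

(** The walk misses n+1 exactly when it visits n and then makes a double step. *)
Lemma massS n : mass n.+1 = 1 - sigma ^+ 2 * mass n.
Proof.
elim: n => [|n IHn]; first by rewrite renewal0 renewal1 sigma_sqr; ring.
rewrite renewal_rec IHn /comp /= sigma_sqr.
move: (mass n) => a; have := sigma_sqr; move: sigma => s ss; ring: ss.
Qed.

Lemma mass_le1 n : mass n <= 1.
Proof.
case: n => [|n]; first by rewrite renewal0.
by rewrite massS lerBlDr lerDl mulr_ge0 ?sqr_ge0 ?renewal_ge0 // => k.
Qed.

(** The limit is 1 / (1 + sigma^2), about 0.724. The value [sigma] at 1 is too small, which is why n
    starts at 2. *)
Lemma mass_ge n : (2 <= n)%N -> 7 / 10 <= mass n.
Proof.
have ss := sigma_sqr; have sl := sigma_lt; have sg := sigma_gt.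
case: n => [|n] // n0.
have m_le : mass n <= 1 - sigma ^+ 2 * sigma.
  case: n n0 => [|n] // _; rewrite massS lerD2l lerN2 ler_wpM2l ?sqr_ge0 //.
  case: n => [|n]; first by rewrite renewal0; lra.
  by rewrite massS ss; have := mass_le1 n; nra.
by rewrite massS; move: m_le; rewrite ss; nra.
Qed.

(* [deviation n k] is a martingale along the walk.                            *)
Definition drift : R := sigma / (1 + 2 * sigma).
Definition deviation n (k : nat) : R := k%:R - drift * n%:R.

(* Stopping the walk at the first position >= n.+1 makes the second moment    *)
(* proportional to the expected position, whence the exact identity.          *)
Lemma stopped_second_moment n :
  renewal n.+1 (fun k => deviation n.+1 k ^+ 2) +
    sigma ^+ 2 * renewal n (fun k => deviation n.+2 k.+1 ^+ 2) =
  drift ^+ 2 * (1 + sigma) / (1 + sigma ^+ 2) * (n.+1%:R + sigma ^+ 2 * mass n).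
Proof.
have s0 := sigma_gt0.
have d0 : 1 + 2 * sigma != 0 by apply: lt0r_neq0; lra.
have c0 : 1 + sigma ^+ 2 != 0 by apply: lt0r_neq0; rewrite sigma_sqr; have := sigma_lt; lra.
have ss := sigma_sqr.
(* A single step changes the deviation by -[drift], a double step by 1 - 2 [drift]; the mean change
   is 0. Its variance is drift^2 (1 + sigma), and 1 + sigma^2 is the mean step length. *)
have bal : sigma * drift = sigma ^+ 2 * (1 - 2 * drift).
  by rewrite /drift; field.
have var : sigma ^+ 2 * (1 - 2 * drift) ^+ 2 = drift ^+ 2.
  rewrite -[in RHS](mulKf (lt0r_neq0 s0) drift) bal; field.
  exact: lt0r_neq0.
have step (y : R) : sigma * (y - drift) ^+ 2 +
    sigma ^+ 2 * (y + (1 - 2 * drift)) ^+ 2 = y ^+ 2 + drift ^+ 2 * (1 + sigma).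
  transitivity ((sigma + sigma ^+ 2) * y ^+ 2
    - 2 * y * (sigma * drift - sigma ^+ 2 * (1 - 2 * drift))
    + (sigma * drift ^+ 2 + sigma ^+ 2 * (1 - 2 * drift) ^+ 2)); first by ring.
  by rewrite bal subrr var ss; ring.
elim: n => [|n IHn].
  rewrite !renewal0 renewal1 /deviation mulr1.
  have -> : (drift ^+ 2 * (1 + sigma) / (1 + sigma ^+ 2) * (1 + sigma ^+ 2)) =
      drift ^+ 2 * (1 + sigma) by field.
  by have := step 0; rewrite expr0n [RHS]add0r => <-; ring.
rewrite renewal_rec -addrA [X in _ + X]addrC addrA.
have -> : sigma * renewal n.+1 (fun k => deviation n.+2 k ^+ 2) +
   sigma ^+ 2 * renewal n.+1 (fun k => deviation n.+3 k.+1 ^+ 2)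
   = renewal n.+1 (fun k => deviation n.+1 k ^+ 2) +
     drift ^+ 2 * (1 + sigma) * mass n.+1.
  rewrite -!renewalZ -!renewalD; apply: eq_renewal => k.
  rewrite mulr1 -step /deviation -!natr1; congr (_ * _ ^+ 2 + _ * _ ^+ 2); ring.
rewrite /comp /= addrAC IHn massS -[n.+2%:R]natr1.
by field.
Qed.

Lemma renewal_second_moment n : (0 < n)%N ->
  renewal n (fun k => deviation n k ^+ 2) <= 179 / 2000 * n.+1%:R.
Proof.
case: n => // n _; have := stopped_second_moment n.
have ss := sigma_sqr; have sl := sigma_lt; have sg := sigma_gt.
have d0 : 1 + 2 * sigma != 0 by apply: lt0r_neq0; lra.
(* The left side is 1 / (5 sqrt 5), about 0.08944. *)
have v_le : drift ^+ 2 * (1 + sigma) / (1 + sigma ^+ 2) <= 179 / 2000.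
  have -> : drift ^+ 2 * (1 + sigma) = sigma / 5.
    rewrite /drift expr_div_n (_ : (1 + 2 * sigma) ^+ 2 = 5); last by ring: ss.
    by ring: ss.
  by rewrite ss ler_pdivrMr; lra.
have tail0 : 0 <= sigma ^+ 2 * renewal n (fun k => deviation n.+2 k.+1 ^+ 2).
  by rewrite mulr_ge0 ?sqr_ge0 ?renewal_ge0 // => k; rewrite sqr_ge0.
have m_le : sigma ^+ 2 * mass n <= 1.
  by rewrite mulr_ile1 ?sqr_ge0 ?renewal_ge0 ?mass_le1 //; lra.
have m_ge : 0 <= sigma ^+ 2 * mass n by rewrite mulr_ge0 ?sqr_ge0 ?renewal_ge0.
move=> eqT; apply: (@le_trans _ _ (179 / 2000 * (n.+1%:R + sigma ^+ 2 * mass n))).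
  apply: le_trans (ler_wpM2r _ v_le); last by rewrite addr_ge0.
  by rewrite -eqT lerDl.
by rewrite -[n.+2%:R]natr1 ler_wpM2l ?lerD2l //; lra.
Qed.

Lemma card_window (N : nat) (a L : R) : 0 <= L ->
  #|[set k : 'I_N | `|(k : nat)%:R - a| <= L]|%:R <= 2 * L + 1.
Proof.
move=> L0; set W := [set k | _].
have [->|[k0 k0W]] := set_0Vmem W; first by rewrite cards0; lra.
case: (@arg_minnP _ k0 (mem W) val k0W) => i iW i_min.
case: (@arg_maxnP _ k0 (mem W) val k0W) => j jW j_max.
have leij : (i <= j)%N by exact: i_min.
have : (#|W| <= (j - i).+1)%N.
  rewrite -(size_iota i (j - i).+1) cardE -(size_map val).
  apply: uniq_leq_size; first by rewrite map_inj_uniq ?enum_uniq //; apply: val_inj.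
  move=> x /mapP[k]; rewrite mem_enum => kW ->.
  by rewrite mem_iota i_min //= addnS subnKC // ltnS; apply: j_max.
rewrite -(ler_nat R) => /le_trans; apply.
move: iW jW; rewrite !inE !ler_norml -natr1 natrB // => /andP[? ?] /andP[? ?].
lra.
Qed.

(* Chebyshev: the window |deviation| <= L carries mass at least 7/10 - 7/30   *)
(* and has at most 2L + 1 points.                                             *)
Lemma exists_large_binomial n (L : R) : (2 <= n)%N -> 0 < L ->
    (n.+1%:R) * (537 / 1400) <= L ^+ 2 ->
  exists k : nat, 7 / 15 <= 'C(n - k, k)%:R * sigma ^+ n * (2 * L + 1).
Proof.
move=> n2 L0 hL.
case: (@Order.TotalTheory.arg_maxP _ _ 'I_n.+1 ord0 xpredT
  (fun k => 'C(n - k, k)) isT) => k _ k_max.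
exists k.
have s0 := sigma_gt0.
have C0 : 0 <= 'C(n - k, k)%:R * sigma ^+ n by rewrite mulr_ge0 // exprn_ge0 // ltW.
apply: le_trans (ler_wpM2l C0 (card_window n.+1 (drift * n%:R) (ltW L0))).
have m1 := mass_ge n2; have m2 := @renewal_second_moment n (ltnW n2).
have L20 : 0 < L ^+ 2 by rewrite exprn_gt0.
(* The function 1 - deviation^2 / L^2 lies below the indicator of the window. Losing a third of the
   mass, 7/30, is the best trade against the window's width 2L; it gives 537/1400 = (179/2000)
   (30/7). *)
apply: (@le_trans _ _ (renewal n (fun j => 1 + (- (L ^+ 2)^-1) * deviation n j ^+ 2))).
  rewrite renewalD renewalZ.
  have : renewal n (fun j => deviation n j ^+ 2) / L ^+ 2 <= 7 / 30.
    by rewrite ler_pdivrMr //; apply: le_trans m2 _; lra.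
  lra.
rewrite -sum1_card natr_sum mulr_sumr [leRHS]big_mkcond /=.
apply: ler_sum => j _; rewrite inE mulr1.
have Cj0 : 0 <= 'C(n - j, j)%:R * sigma ^+ n by rewrite mulr_ge0 // exprn_ge0 // ltW.
case: ifPn => [_|].
  apply: (@le_trans _ _ ('C(n - j, j)%:R * sigma ^+ n)).
    by rewrite ler_piMr // mulNr lerBlDr lerDl mulr_ge0 ?invr_ge0 ?sqr_ge0.
  by rewrite ler_wpM2r ?exprn_ge0 ?(ltW s0) // ler_nat; exact: k_max.
rewrite -ltNge => Ld; rewrite mulr_ge0_le0 // mulNr subr_le0 ler_pdivlMl // mulr1.
by rewrite -[leRHS]real_normK ?num_real // lerXn2r ?nnegrE ?normr_ge0 // ltW.
Qed.

End Sigma.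

(** * The two bounds *)

Section LowerBound.
Variables (R : realType) (n : nat).
Implicit Types (x y t : n.-tuple bool) (D : {set n.-tuple bool}).
Local Notation sigma := (sigma R).

Definition weight t D := \sum_(x in D) sigma ^+ #|diffset x t|.

Lemma diffset_adj x y t :
  hypercube x y -> (#|diffset x t| <= #|diffset y t|.+1)%N.
Proof.
move=> /eqP xy; apply: leq_trans (subset_leq_card (diffset_triangle x y t)) _.
by apply: leq_trans (leq_card_setU _ _).1 _; rewrite [X in (X + _)%N]xy.
Qed.

(** If [w] is at distance d from [t], then [v] and [u] are at distance at most d+1 and d+2, so the
    pegs removed weigh at least sigma^d. *)
Lemma weight_move t D D' : pegging_move (@hypercube n) D D' ->
  weight t D' <= weight t D.
Proof.
have s0 := sigma_gt0 R.
have s1 : 0 <= sigma <= 1 by rewrite ltW //=; have := sigma_lt R; lra.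
case/existsP=> u /existsP[v /existsP[w]].
case/and5P=> uD vD uv euv /and3P[wD evw /eqP ->]; rewrite /weight.
rewrite big_setU1 /=; last by rewrite !inE negb_and wD orbT.
rewrite [leRHS](big_setID [set u; v]) /= lerD2r.
have -> : D :&: [set u; v] = [set u; v].
  by apply/setIidPr; rewrite subUset !sub1set uD.
rewrite big_setU1 ?inE //= big_set1.
have vw := diffset_adj t evw.
have uw : (#|diffset u t| <= #|diffset w t|.+2)%N.
  exact: leq_trans (diffset_adj t euv) _.
apply: (@le_trans _ _ (sigma ^+ #|diffset w t|.+2 + sigma ^+ #|diffset w t|.+1)).
  by rewrite !exprS mulrA -expr2 sigma_sqr -mulrDl subrK mul1r.
by apply: lerD; apply: ler_wiXn2l; case/andP: s1.
Qed.

Lemma weight_reach t D : t \in Reach (@hypercube n) D -> 1 <= weight t D.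
Proof.
case/ReachP=> D' /connectP[p]; elim: p D => [|D1 p IHp] D /=.
  move=> _ -> tD; rewrite /weight (bigD1 t) //= (_ : diffset t t = set0).
    rewrite cards0 lerDl sumr_ge0 // => x _.
    by rewrite exprn_ge0 // ltW // sigma_gt0.
  by apply/setP=> i; rewrite !inE eqxx.
by case/andP=> mD pD1 lD tD; apply: le_trans (IHp _ pD1 lD tD) (weight_move t mD).
Qed.

Lemma sum_sigma_diffset x :
  \sum_(t : n.-tuple bool) sigma ^+ #|diffset x t| = (1 + sigma) ^+ n.
Proof.
rewrite (reindex (flip x)) /=; last first.
  by exists (diffset x) => A _; rewrite ?diffset_flip ?flip_diffset.
under eq_bigr do rewrite diffset_flip.
transitivity (\prod_(i < n) (sigma + 1)); last first.
  by rewrite prodr_const card_ord addrC.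
rewrite bigA_distr; apply: eq_bigr => A _.
by rewrite -big_mkcond /= prodr_const.
Qed.

Lemma pegging_lower_bound D : Reach (@hypercube n) D = setT ->
  (2 * sigma) ^+ n <= #|D|%:R.
Proof.
move=> RD; have s0 := sigma_gt0 R.
have : (2 ^+ n : R) <= #|D|%:R * (1 + sigma) ^+ n.
  have -> : 2 ^+ n = \sum_(t : n.-tuple bool) 1 :> R.
    by rewrite sumr_const card_tuple card_bool natrX.
  apply: (@le_trans _ _ (\sum_t weight t D)).
    by apply: ler_sum => t _; apply: weight_reach; rewrite RD.
  rewrite exchange_big /= (eq_bigr (fun=> (1 + sigma) ^+ n)) => [|x _].
    by rewrite sumr_const mulr_natl.
  exact: sum_sigma_diffset.
move/(ler_wpM2r (exprn_ge0 n (ltW s0))).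
rewrite -mulrA -!exprMn (_ : (1 + sigma) * sigma = 1) ?expr1n ?mulr1 //.
by ring: (sigma_sqr R).
Qed.

End LowerBound.

(** * Upper bound: size of the cover and explicit constants *)

Section UpperBound.
Variable R : realType.
Local Notation sigma := (sigma R).

(** Start from exp y >= 1 + y at y = 7/640 and square six times, rounding down to small fractions on
    the way. *)
Lemma expR_ge2 : 2 <= expR (7 / 10 : R).
Proof.
have -> : 7 / 10 = (2 ^ 6)%:R * (7 / 640) :> R by field.
rewrite expRM_natl; have := expR_ge1Dx (7 / 640 : R).
set x := expR _ => x1.
have sq (y b c : R) : b <= y -> 0 <= b -> c <= b ^+ 2 -> c <= y ^+ 2.
  by move=> yb b0 /le_trans; apply; rewrite lerXn2r ?nnegrE // (le_trans b0).
rewrite (exprM x 2 32) (exprM _ 2 16) (exprM _ 2 8) (exprM _ 2 4) (exprM _ 2 2).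
apply: (sq _ (956 / 675)); [|lra..].
apply: (sq _ (144 / 121)); [|lra..].
apply: (sq _ (12 / 11)); [|lra..].
apply: (sq _ (869 / 832)); [|lra..].
apply: (sq _ (697 / 682)); [|lra..].
apply: (sq _ _ _ x1); lra.
Qed.

(** (1 - d / 2^n)^s <= exp(-s d / 2^n) < exp(-7n/10) <= 2^-n. *)
Lemma cover_size_suffices (n d s : nat) : (d <= 2 ^ n)%N ->
    7 / 10 * n%:R * 2 ^+ n < s%:R * d%:R :> R ->
  (2 ^ n * (2 ^ n - d) ^ s < (2 ^ n) ^ s)%N.
Proof.
move=> dN hs; rewrite -(ltr_nat R) natrM !natrX natrB // natrX.
have N0 : 0 < 2 ^+ n :> R by rewrite exprn_gt0.
set N : R := 2 ^+ n in N0 hs *.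
have -> : N - d%:R = N * (1 - d%:R / N) by field; exact: lt0r_neq0.
rewrite exprMn mulrCA -[ltRHS]mulr1 ltr_pM2l ?exprn_gt0 //.
have q0 : 0 <= 1 - d%:R / N.
  by rewrite subr_ge0 ler_pdivrMr // mul1r /N -natrX ler_nat.
apply: (@le_lt_trans _ _ (N * expR (- (d%:R / N)) ^+ s)).
  by rewrite ler_pM2l // lerXn2r ?nnegrE ?expR_ge0 //; exact: expR_ge1Dx.
apply: (@lt_le_trans _ _ (N * expR (- (7 / 10)) ^+ n)).
  rewrite ltr_pM2l // -!expRM_natl ltr_expR !mulrN ltrN2 [s%:R * _]mulrA ltr_pdivlMr //.
  by rewrite [_ * (7 / 10)]mulrC.
rewrite expRN exprVn ler_pdivrMr ?exprn_gt0 ?expR_gt0 // mul1r.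
by rewrite lerXn2r ?nnegrE ?expR_ge0 ?expR_ge2.
Qed.

Lemma pegging_upper_binomial n k : (0 < 'C(n - k, k))%N ->
  (optimal_pegging_number (@hypercube n))%:R * 'C(n - k, k)%:R
    <= (7 / 10 * n%:R + 1) * 2 ^+ n :> R.
Proof.
move=> b0; have kn : (k <= n)%N.
  by move: b0; rewrite bin_gt0 => /leq_trans; apply; rewrite leq_subr.
have [S Sk] : exists S : {set 'I_n}, #|S| = k.
  have : (0 < #|[set A : {set 'I_n} | #|A| == k]|)%N by rewrite card_draws card_ord bin_gt0.
  by case/card_gt0P=> S; rewrite inE => /eqP; exists S.
set b := 'C(n - k, k) in b0 *; pose d := (2 ^ k * b)%N.
have d0 : 0 < d%:R :> R by rewrite ltr0n muln_gt0 expn_gt0.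
have dN : (d <= 2 ^ n)%N.
  have := card_flat_ball S [tuple false | i < n] #|S|; rewrite Sk => /leq_trans.
  by apply; rewrite (leq_trans (max_card _)) // card_tuple card_bool.
pose x : R := 7 / 10 * n%:R * 2 ^+ n / d%:R.
have x0 : 0 <= x by rewrite divr_ge0 ?mulr_ge0 ?exprn_ge0 //; lra.
have /andP[x_ge x_lt] := truncn_itv x0.
(* The least integer above [x] is at most [x] + 1; the extra subcube costs [d] <= 2^n after
   multiplication by [b], hence the summand 1 in the bound. *)
have := @optimal_pegging_cover n S (Num.truncn x).+1; rewrite Sk -/b -/d.
move/(_ (cover_size_suffices dN _)); rewrite -ltr_pdivrMr // => /(_ x_lt).
rewrite -(ler_nat R) => /(ler_wpM2r (ler0n R b)) /le_trans; apply.
rewrite natrM -mulrA -natrM -/d -natr1 mulrDl mul1r mulrDl mul1r.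
apply: lerD; last by rewrite -natrX ler_nat.
by rewrite -ler_pdivlMr.
Qed.

Lemma power_3_2 n : (2 * n%:R) `^ (3 / 2) = 2 * n%:R * Num.sqrt (2 * n%:R) :> R.
Proof.
have n0 : 0 <= 2 * n%:R :> R by rewrite mulr_ge0.
have -> : 3 / 2 = 1 + 2^-1 :> R by field.
rewrite powRD; last by apply/implyP => /eqP; lra.
by rewrite powRr1 // powR12_sqrt.
Qed.

Lemma sqrt_ge (c a : R) : 0 <= c -> c ^+ 2 <= a -> c <= Num.sqrt a.
Proof.
by move=> c0 ca; rewrite -[leLHS]ger0_norm // -sqrtr_sqr ler_wsqrtr.
Qed.

Lemma window_numeric (x q : R) : 79 / 25 <= x -> 707 / 500 <= q ->
  (7 / 10 * x ^+ 2 + 1) * (2 * (31 / 50 * (x + (2 * x)^-1)) + 1) * (15 / 7)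
    <= 2 * x ^+ 2 * (q * x).
Proof.
move=> hx hq; have x0 : 0 < x by lra.
rewrite -(ler_pM2r x0).
have -> : (7 / 10 * x ^+ 2 + 1) * (2 * (31 / 50 * (x + (2 * x)^-1)) + 1) * (15 / 7) * x =
  (7 / 10 * x ^+ 2 + 1) * (31 / 25 * x ^+ 2 + 31 / 50 + x) * (15 / 7).
  by field; exact: lt0r_neq0.
apply: (@le_trans _ _ (2 * x ^+ 2 * (707 / 500 * x) * x)); last first.
  rewrite ler_pM2r // ler_wpM2l ?ler_pM2r //.
  by rewrite mulr_ge0 ?sqr_ge0.
have : 0 <= x - 79 / 25 by lra.
(* In terms of [r] the difference of the two sides has nonnegative coefficients, so [lra] can treat
   the powers of [r] as atoms. *)
move: (x - 79 / 25) (subrK (79 / 25) x) => r <- r0.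
have r2 : 0 <= r ^+ 2 by exact: sqr_ge0.
have r3 : 0 <= r ^+ 3 by rewrite exprn_ge0.
have r4 : 0 <= r ^+ 4 by rewrite exprn_ge0.
rewrite -subr_ge0.
lra.
Qed.

Lemma pegging_upper_large n : (10 <= n)%N ->
  (optimal_pegging_number (@hypercube n))%:R
    <= 2 * n%:R * Num.sqrt (2 * n%:R) * (2 * sigma) ^+ n :> R.
Proof.
move=> n10; have s0 := sigma_gt0 R.
pose x : R := Num.sqrt n%:R.
have x2 : x ^+ 2 = n%:R by rewrite sqr_sqrtr.
have n10R : 10 <= n%:R :> R by rewrite ler_nat.
have x_ge : 79 / 25 <= x by apply: sqrt_ge; lra.
have x0 : 0 < x by lra.
have q_ge : 707 / 500 <= Num.sqrt 2 :> R by apply: sqrt_ge; lra.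
(* 31/50 slightly exceeds sqrt(537/1400), and x + 1/(2x) >= sqrt(n+1) keeps [L] rational in [x]. *)
pose L := 31 / 50 * (x + (2 * x)^-1).
have ix0 : 0 < (2 * x)^-1 by rewrite invr_gt0; lra.
have L0 : 0 < L by rewrite /L; lra.
have hL : n.+1%:R * (537 / 1400) <= L ^+ 2.
  rewrite /L exprMn -natr1 -x2.
  have : x ^+ 2 + 1 <= (x + (2 * x)^-1) ^+ 2.
    rewrite sqrrD (_ : x * (2 * x)^-1 *+ 2 = 1); last by field; exact: lt0r_neq0.
    by rewrite lerDl sqr_ge0.
  have := sqr_ge0 x; lra.
have [k hk] := exists_large_binomial (leq_trans (isT : 2 <= 10)%N n10) L0 hL.
have b0 : (0 < 'C(n - k, k))%N.
  by rewrite lt0n; apply/eqP => bk0; move: hk; rewrite bk0 !mul0r; lra.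
have := pegging_upper_binomial b0; move: hk.
set b : R := _%:R; set p : R := (optimal_pegging_number _)%:R => hk hp.
have bR0 : 0 < b by rewrite ltr0n.
have w := window_numeric x_ge q_ge.
rewrite -(ler_pM2r bR0); apply: le_trans hp _.
rewrite sqrtrM // -/x exprMn -x2 -/L in w *.
have sn0 : 0 < sigma ^+ n by rewrite exprn_gt0.
set A := 7 / 10 * x ^+ 2 + 1 in w *.
have A0 : 0 < A by rewrite /A; have := sqr_ge0 x; lra.
have key : A <= 2 * x ^+ 2 * (Num.sqrt 2 * x) * (sigma ^+ n * b).
  apply: (@le_trans _ _ (A * (15 / 7) * (b * sigma ^+ n * (2 * L + 1)))).
    by rewrite -mulrA ler_peMr ?(ltW A0) //; lra.
  have -> : A * (15 / 7) * (b * sigma ^+ n * (2 * L + 1)) =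
      A * (2 * L + 1) * (15 / 7) * (sigma ^+ n * b) by ring.
  by rewrite ler_pM2r // mulr_gt0.
have /(ler_wpM2r (exprn_ge0 n (ler0n R 2))) := key.
move=> /le_trans; apply.
by rewrite le_eqVlt; apply/orP; left; apply/eqP; ring.
Qed.

Lemma pegging_upper_small n : (0 < n < 10)%N ->
  (optimal_pegging_number (@hypercube n))%:R
    <= 2 * n%:R * Num.sqrt (2 * n%:R) * (2 * sigma) ^+ n :> R.
Proof.
move=> n_small.
have : (optimal_pegging_number (@hypercube n) <= 2 ^ n)%N.
  rewrite -[in (2 ^ n)%N]card_bool -card_tuple -cardsT; apply: optimal_pegging_hypercube_le.
  by apply/eqP; rewrite eqEsubset subsetT sub_Reach.
rewrite -(ler_nat R) natrX => /le_trans; apply.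
have ss := sigma_sqr R; have s0 := sigma_gt0 R; have sl := sigma_lt R.
have key : (1 + sigma) ^+ n <= 2 * n%:R * Num.sqrt (2 * n%:R).
  suff [r r_ge0 [r_le H]] : exists2 r : R, 0 <= r &
      r ^+ 2 <= 2 * n%:R /\ (1 + sigma) ^+ n <= 2 * n%:R * r.
    by apply: le_trans H _; rewrite ler_wpM2l ?mulr_ge0 // sqrt_ge.
  (* The coefficients are Fibonacci numbers: (1 + sigma)^n = F(n+1) + F(n) sigma. *)
  have p2 : (1 + sigma) ^+ 2 = 2 + sigma by ring: ss.
  have p3 : (1 + sigma) ^+ 3 = 3 + 2 * sigma by rewrite exprS p2; ring: ss.
  have p4 : (1 + sigma) ^+ 4 = 5 + 3 * sigma by rewrite exprS p3; ring: ss.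
  have p5 : (1 + sigma) ^+ 5 = 8 + 5 * sigma by rewrite exprS p4; ring: ss.
  have p6 : (1 + sigma) ^+ 6 = 13 + 8 * sigma by rewrite exprS p5; ring: ss.
  have p7 : (1 + sigma) ^+ 7 = 21 + 13 * sigma by rewrite exprS p6; ring: ss.
  have p8 : (1 + sigma) ^+ 8 = 34 + 21 * sigma by rewrite exprS p7; ring: ss.
  have p9 : (1 + sigma) ^+ 9 = 55 + 34 * sigma by rewrite exprS p8; ring: ss.
  case: n n_small => [|[|[|[|[|[|[|[|[|[|n]]]]]]]]]] // _.
  - by exists 1 => //; rewrite expr1; split; lra.
  - by exists 2 => //; rewrite p2; split; lra.
  - by exists 2 => //; rewrite p3; split; lra.
  - by exists 2 => //; rewrite p4; split; lra.
  - by exists 3 => //; rewrite p5; split; lra.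
  - by exists 3 => //; rewrite p6; split; lra.
  - by exists 3 => //; rewrite p7; split; lra.
  - by exists 4 => //; rewrite p8; split; lra.
  (* The tight case: about 76.01 against 76.32, with 106/25 just below sqrt 18. *)
  - by exists (106 / 25); [lra|rewrite p9; split; lra].
rewrite exprMn mulrCA ler_peMr ?exprn_ge0 //.
have /(ler_wpM2r (exprn_ge0 n (ltW s0))) := key.
by rewrite -exprMn (_ : (1 + sigma) * sigma = 1) ?expr1n //; ring: ss.
Qed.

End UpperBound.

Theorem theorem5p4 (R : realType) (n : nat) (hn : (0 < n)%N) :
  (Num.sqrt (5 : R) - 1) ^+ n <= (optimal_pegging_number (@hypercube n))%:R
  /\ (optimal_pegging_number (@hypercube n))%:R
     <= (2 * n%:R) `^ (3 / 2) * (Num.sqrt (5 : R) - 1) ^+ n.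
Proof.
rewrite sqrt5_sigma power_3_2; split; last first.
  have [n9|n10] := ltnP n 10; last exact: pegging_upper_large.
  by apply: pegging_upper_small; rewrite hn.
have T0 : (0 < #|{: n.-tuple bool}|)%N by rewrite card_tuple card_bool expn_gt0.
have [/andP[_ /existsP[D /andP[/eqP <- /eqP RD]]] _] :=
  optimal_pegging_numberP (@hypercube n) T0.
exact: pegging_lower_bound.
Qed.
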